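(* Let $1\le n\le m\le\infty$ and let $d[m\to n]:\mathbb{Z}[\vec{\mathscr{A}}[m]]\to\mathbb{Z}[\vec{\mathscr{A}}[n]]$ be the linear map which, on a diagram $D\in\vec{\mathscr{A}}[m]$, relabels by $n+1$ every arrow having label $k>n+1$. For any $t\in\mathbb{N}$, $d[m\to n]$ descends to a map of quotients $d_t[m\to n]:\vec{\mathscr{X}}_t[m]\to\vec{\mathscr{X}}_t[n]$. Moreover, the sequence $\vec{\mathscr{X}}_t[m]\xrightarrow{d_t[m\to n]}\vec{\mathscr{X}}_t[n]\to0$ is exact.
   Context: Diagrams are on a fixed base, the oriented line $\mathbb{R}$ or the oriented circle $S^1$. For $m\in\mathbb{N}\cup\{\infty\}$ ($\infty+1=\infty$), $\vec{\mathscr{A}}[m]$ is the set of signed arrow diagrams: the base with finitely many arrows with distinct endpoints, each arrow carrying a sign $\oplus/\ominus$ and an arbitrary label in $\{1,\dots,m+1\}$ (in $\{1,2,\dots\}\cup\{\infty\}$ if $m=\infty$), up to orientation-preserving homeomorphism. An arrow is isolated if its endpoints are consecutive. Relations in $\mathbb{Z}[\vec{\mathscr{A}}[m]]$: $\vec{\mathrm{Q1}}[m]$: $D=0$ if $D$ has an isolated arrow labelled $m+1$. $\vec{\mathrm{Q2}}[m]$: $D+(D\setminus a)+(D\setminus b)=0$ if $a,b$ are arrows of $D$ with opposite signs, equal labels, adjacent tails and adjacent heads. $\vec{\mathrm{Q3}}[m]$: let $1,2,3$ be disjoint intervals of the base (in any order), and let $D$ have three arrows of equal sign $a:1\to2$,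 $b:1\to3$, $c:2\to3$ whose endpoints occur on interval 1 in the order $a,b$, on interval 2 in the order $a,c$, on interval 3 in the order $b,c$ (no other endpoints on these intervals); let $D'$ be $D$ with the order of the two endpoints reversed on each of the three intervals; the labels $i,j,k$ of $a,b,c$ (the same in $D$ and $D'$) satisfy $i>j=k$, or $j>i=k$, or $k>i=j$, or $i=j=k=m+1$; then $D+(D\setminus a)+(D\setminus b)+(D\setminus c)=D'+(D'\setminus a)+(D'\setminus b)+(D'\setminus c)$. $\vec{A}_t[m]$ is the set of diagrams with more than $t$ arrows, and $\vec{\mathscr{X}}_t[m]=\mathbb{Z}[\vec{\mathscr{A}}[m]]/\langle\vec{\mathrm{Q1}}[m],\vec{\mathrm{Q2}}[m],\vec{\mathrm{Q3}}[m],\vec{A}_t[m]\rangle$. *)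

(* Defs.v *)
From HB Require Import structures.
From mathcomp Require Import all_boot all_order all_algebra.
From mathcomp Require Import generic_quotient ring_quotient.
From mathcomp Require Import all_classical reals topology normedtype.
From mathcomp.multinomials Require Import freeg.

Set Implicit Arguments.
Unset Strict Implicit.
Unset Printing Implicit Defensive.

Import Order.TTheory GRing.Theory Num.Theory.
Import numFieldNormedType.Exports.
Local Open Scope classical_set_scope.
Local Open Scope ring_scope.
Local Open Scope quotient_scope.

(* [None] is infinity *)
Notation enat := (option nat).

Definition ele (x y : enat) : bool :=
  match x, y with
  | _, None => true
  | None, Some _ => false
  | Some k, Some l => (k <= l)%N
  end.

Definition elt (x y : enat) : bool := ~~ ele y x.

Definition esucc (x : enat) : enat := omap succn x.

(* For m = infinity this is {1, 2, ...} together with infinity. *)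
Definition is_label (m : enat) : pred enat :=
  fun k => ele (Some 1%N) k && ele k (esucc m).

Definition label (m : enat) : Type := {k : enat | is_label m k}.
HB.instance Definition _ m := Choice.on (label m).

Lemma ele_refl x : ele x x.
Proof. by case: x => /=. Qed.

Lemma is_label_top m : is_label m (esucc m).
Proof. by rewrite /is_label ele_refl andbT; case: m. Qed.

Definition top_label (m : enat) : label m :=
  exist (fun k => is_true (is_label m k)) _ (is_label_top m).

(* Labels larger than n + 1 become n + 1; the others are unchanged. *)
Definition cap (n k : enat) : enat :=
  if elt (esucc n) k then esucc n else k.

Lemma is_label_cap m n (k : label m) : is_label n (cap n (sval k)).
Proof.
case: k => k /=; rewrite /is_label /cap /elt => /andP[k1 _].
by case: ifPn => [_|/negPn ->]; [exact: is_label_top|rewrite k1].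
Qed.

Definition cap_label m n (k : label m) : label n :=
  exist (fun l => is_true (is_label n l)) _ (is_label_cap n k).

(* [before p q]: there is an arc running from [p] to [q] in the direction of
   the orientation; [between p z q]: [z] lies in the interior of that arc.
   On the circle such an arc exists for all p != q, on the line for p < q. *)
Record obase := OBase {
  pt :> topologicalType;
  before : rel pt;
  between : pt -> pt -> pt -> bool }.

Section Bases.
Variable R : realType.

Definition line : obase :=
  @OBase (R : topologicalType) (fun p q => p < q) (fun p z q => p < z < q).

Definition unit_circle : set (R * R)%type :=
  [set z | z.1 ^+ 2 + z.2 ^+ 2 = 1].

(* Three points of the unit circle are met in the order x, y, z when travelling
   counterclockwise iff the triangle xyz is positively oriented. *)
Definition ccw (x y z : (R * R)%type) : bool :=
  0 < (y.1 - x.1) * (z.2 - x.2) - (y.2 - x.2) * (z.1 - x.1).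

Definition circle : obase :=
  @OBase (set_type unit_circle : topologicalType)
    (fun p q => p != q)
    (fun p z q => ccw (set_val p) (set_val z) (set_val q)).

Variant base_kind := Line | Circle.

Definition base (k : base_kind) : obase :=
  match k with Line => line | Circle => circle end.

End Bases.

Definition oriented_homeo (B : obase) (f : B -> B) : Prop :=
  [/\ continuous f,
      exists g : B -> B, [/\ cancel f g, cancel g f & continuous g],
      {mono f : p q / before p q} &
      forall p z q, between (f p) (f z) (f q) = between p z q].

(* The sign [true] is the positive one. *)
Record arrow (B : obase) (m : enat) := Arrow {
  atail : B;
  ahead : B;
  asign : bool;
  alabel : label m }.

Section ArrowChoice.
Variables (B : obase) (m : enat).

Definition arrow_tuple (a : arrow B m) : B * B * bool * label m :=
  (atail a, ahead a, asign a, alabel a).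
Definition tuple_arrow (u : B * B * bool * label m) : arrow B m :=
  Arrow u.1.1.1 u.1.1.2 u.1.2 u.2.
Lemma arrow_tupleK : cancel arrow_tuple tuple_arrow.
Proof. by case. Qed.
HB.instance Definition _ := Choice.copy (arrow B m) (can_type arrow_tupleK).
End ArrowChoice.

Definition endpoints (B : obase) (m : enat) (s : seq (arrow B m)) : seq B :=
  flatten [seq [:: atail a; ahead a] | a <- s].

(* A diagram drawn on the base: the arrows are listed in an arbitrary order,
   which [diag_iso] forgets. *)
Record diagram (B : obase) (m : enat) := Diagram {
  arrows :> seq (arrow B m);
  _ : uniq (endpoints arrows) }.

Lemma endpoints_uniq (B : obase) (m : enat) (D : diagram B m) :
  uniq (endpoints D).
Proof. by case: D. Qed.

HB.instance Definition _ (B : obase) (m : enat) := [isSub for @arrows B m].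
HB.instance Definition _ (B : obase) (m : enat) :=
  [Choice of diagram B m by <:].

Definition move_arrow (B : obase) (m : enat) (f : B -> B)
    (a : arrow B m) : arrow B m :=
  Arrow (f (atail a)) (f (ahead a)) (asign a) (alabel a).

Definition diag_iso (B : obase) (m : enat) (D D' : diagram B m) : Prop :=
  exists2 f : B -> B, oriented_homeo f & perm_eq (map (move_arrow f) D) D'.

Definition diag_isob (B : obase) (m : enat) : rel (diagram B m) :=
  fun D D' => `[< diag_iso D D' >].

Lemma diag_iso_refl (B : obase) (m : enat) : reflexive (@diag_isob B m).
Proof.
move=> D; apply/asboolP; exists id.
  by split=> //; [move=> x; exact: cvg_id|exists id; split=> // x; exact: cvg_id].
by rewrite (@eq_map _ _ _ id) ?map_id // => -[].
Qed.

Lemma diag_iso_sym (B : obase) (m : enat) : symmetric (@diag_isob B m).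
Proof.
suff sym : forall D D' : diagram B m, diag_iso D D' -> diag_iso D' D.
  by move=> D D'; apply/idP/idP => /asboolP /sym ?; apply/asboolP.
move=> D D' [f [cf [g [fK gK cg]] f2 f3] DD']; exists g.
  split=> //; first by exists f.
    by move=> p q; rewrite -f2 !gK.
  by move=> p z q; rewrite -f3 !gK.
have := perm_map (move_arrow g) DD'; rewrite perm_sym -map_comp.
rewrite (@eq_map _ _ (_ \o _) id) ?map_id //.
by case=> p q s k; rewrite /move_arrow /= !fK.
Qed.

Lemma diag_iso_trans (B : obase) (m : enat) : transitive (@diag_isob B m).
Proof.
move=> D2 D1 D3 /asboolP[f [cf [f' [fK f'K cf']] f2 f3] D12].
move=> /asboolP[g [cg [g' [gK g'K cg']] g2 g3] D23]; apply/asboolP.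
exists (g \o f).
  split.
  - by move=> x; apply: continuous_comp; [exact: cf|exact: cg].
  - exists (f' \o g'); split; [exact: can_comp|exact: can_comp|].
    by move=> x; apply: continuous_comp; [exact: cg'|exact: cf'].
  - by move=> p q /=; rewrite g2 f2.
  - by move=> p z q /=; rewrite g3 f3.
apply: perm_trans D23; have := perm_map (move_arrow g) D12.
by rewrite -map_comp.
Qed.

Canonical diag_iso_equiv (B : obase) (m : enat) :=
  EquivRel (@diag_isob B m) (@diag_iso_refl B m) (@diag_iso_sym B m)
    (@diag_iso_trans B m).

Definition adiag (B : obase) (m : enat) : Type :=
  {eq_quot (diag_iso_equiv B m)}.
HB.instance Definition _ (B : obase) (m : enat) := Choice.on (adiag B m).
HB.instance Definition _ (B : obase) (m : enat) := EqQuotient.on (adiag B m).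

Definition zdiag (B : obase) (m : enat) : Type := {freeg (adiag B m) / int}.
HB.instance Definition _ (B : obase) (m : enat) :=
  GRing.Lmodule.on (zdiag B m).

Definition gen (B : obase) (m : enat) (D : diagram B m) : zdiag B m :=
  << \pi_(adiag B m) D >>.

Lemma del_uniq (B : obase) (m : enat) (D : diagram B m) (a : arrow B m) :
  uniq (endpoints (rem a D)).
Proof.
apply: subseq_uniq (endpoints_uniq D).
elim: (arrows D) => //= b s IHs; case: eqP => _.
  by apply: (@suffix_subseq _ [:: atail b; ahead b]).
by rewrite /endpoints /= !eqxx.
Qed.

Definition del (B : obase) (m : enat) (D : diagram B m) (a : arrow B m) :
    diagram B m :=
  Diagram (del_uniq D a).

Section Relations.
Variables (B : obase) (m : enat).
Implicit Types (D : diagram B m) (a b c : arrow B m) (p q r : B).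

(* [q] is the endpoint of [D] met immediately after [p] (for endpoints p, q
   of D) when following the orientation. *)
Definition follows D p q : bool :=
  before p q && all (fun z => ~~ between p z q) (endpoints D).

Definition adjacent D p q : bool := follows D p q || follows D q p.

Definition isolated D a : bool := adjacent D (atail a) (ahead a).

Inductive Q1 : set (zdiag B m) :=
| Q1_intro D a of a \in arrows D & isolated D a & alabel a = top_label m :
    Q1 (gen D).

Inductive Q2 : set (zdiag B m) :=
| Q2_intro D a b of a \in arrows D & b \in arrows D
    & asign a != asign b & alabel a = alabel b
    & adjacent D (atail a) (atail b) & adjacent D (ahead a) (ahead b) :
    Q2 (gen D + gen (del D a) + gen (del D b)).

Definition Q3_labels (i j k : label m) : Prop :=
  [\/ elt (sval j) (sval i) /\ j = k,
      elt (sval i) (sval j) /\ i = k,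
      elt (sval i) (sval k) /\ i = j |
      [/\ i = j, j = k & k = top_label m]].

(* The minimal intervals 1, 2, 3 are the arcs from p1 to p2, from q1 to q2 and
   from r1 to r2; as they contain no endpoint in their interior, they are
   disjoint, and nothing is assumed on their relative positions.  Exchanging
   the two endpoints on each of them turns a, b, c into a', b', c', while the
   other arrows E are unchanged. *)
Inductive Q3 : set (zdiag B m) :=
| Q3_intro D D' (E : seq (arrow B m)) p1 p2 q1 q2 r1 r2 (s : bool)
    (i j k : label m)
    (a := Arrow p1 q1 s i) (b := Arrow p2 r1 s j) (c := Arrow q2 r2 s k)
    (a' := Arrow p2 q2 s i) (b' := Arrow p1 r2 s j) (c' := Arrow q1 r1 s k)
    of perm_eq D [:: a, b, c & E] & perm_eq D' [:: a', b', c' & E]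
    & follows D p1 p2 & follows D q1 q2 & follows D r1 r2 & Q3_labels i j k :
    Q3 (gen D + gen (del D a) + gen (del D b) + gen (del D c)
        - (gen D' + gen (del D' a') + gen (del D' b') + gen (del D' c'))).

Inductive At (t : nat) : set (zdiag B m) :=
| At_intro D of (t < size D)%N : At t (gen D).

Definition relators (t : nat) : set (zdiag B m) :=
  Q1 `|` Q2 `|` Q3 `|` At t.

End Relations.

Definition zspan (V : zmodType) (G : set V) : set V :=
  smallest [set H | H 0 /\ forall x y, H x -> H y -> H (x - y)] G.

Definition zspanb (V : zmodType) (G : set V) : V -> bool :=
  fun x => `[< zspan G x >].

Lemma zspanb_closed (V : zmodType) (G : set V) : zmod_closed (zspanb G).
Proof.
split; first by apply/asboolP => H [[]].
move=> x y /asboolP Gx /asboolP Gy; apply/asboolP => H HG.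
by case: (HG) => -[_ HB] _; apply: HB; [exact: Gx|exact: Gy].
Qed.

HB.instance Definition _ (V : zmodType) (G : set V) :=
  GRing.isZmodClosed.Build V (zspanb G) (zspanb_closed G).

Definition Xquot (B : obase) (t : nat) (m : enat) : zmodType :=
  Quotient.quot (GRing.ZmodClosed.clone _ (zspanb (@relators B m t)) _).

Definition Xpi (B : obase) (t : nat) (m : enat) : zdiag B m -> Xquot B t m :=
  \pi.

Lemma Xpi_is_zmod_morphism (B : obase) (t : nat) (m : enat) :
  zmod_morphism (@Xpi B t m).
Proof. by move=> x y; rewrite /Xpi raddfB. Qed.

HB.instance Definition _ (B : obase) (t : nat) (m : enat) :=
  GRing.isZmodMorphism.Build (zdiag B m) (Xquot B t m) (@Xpi B t m)
    (@Xpi_is_zmod_morphism B t m).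

Definition relabel_arrow (B : obase) (m n : enat) (a : arrow B m) : arrow B n :=
  Arrow (atail a) (ahead a) (asign a) (cap_label n (alabel a)).

Lemma endpoints_relabel (B : obase) (m n : enat) (s : seq (arrow B m)) :
  endpoints (map (@relabel_arrow B m n) s) = endpoints s.
Proof. by rewrite /endpoints -map_comp. Qed.

Lemma relabel_uniq (B : obase) (m n : enat) (D : diagram B m) :
  uniq (endpoints (map (@relabel_arrow B m n) D)).
Proof. by rewrite endpoints_relabel endpoints_uniq. Qed.

Definition relabel (B : obase) (m n : enat) (D : diagram B m) : diagram B n :=
  Diagram (relabel_uniq n D).

Lemma relabel_iso (B : obase) (m n : enat) (D D' : diagram B m) :
  diag_iso D D' -> diag_iso (relabel n D) (relabel n D').
Proof.
case=> f fh /(perm_map (@relabel_arrow B m n)) DD'; exists f => //=.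
by apply: perm_trans DD'; rewrite -!map_comp.
Qed.

Definition dmap (B : obase) (m n : enat) : zdiag B m -> zdiag B n :=
  fglift (fun D : adiag B m => gen (relabel n (repr D)) : zdiag B n).

Lemma dmap_is_zmod_morphism (B : obase) (m n : enat) :
  zmod_morphism (@dmap B m n).
Proof. exact: lift_is_additive. Qed.

HB.instance Definition _ (B : obase) (m n : enat) :=
  GRing.isZmodMorphism.Build (zdiag B m) (zdiag B n) (@dmap B m n)
    (@dmap_is_zmod_morphism B m n).

Lemma dmap_gen (B : obase) (m n : enat) (D : diagram B m) :
  dmap n (gen D) = gen (relabel n D).
Proof.
rewrite /dmap /gen liftU scale1r; congr (<< _ >>); apply/eqmodP/asboolP.
by apply/relabel_iso/asboolP; rewrite -/(diag_isob _ _) -eqmodE reprK.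
Qed.

Definition is_exact (U V W : zmodType) (f : U -> V) (g : V -> W) : Prop :=
  range f = g @^-1` [set 0].

(* Main.v *)
Require Import Defs.
From HB Require Import structures.
From mathcomp Require Import all_boot all_order all_algebra.
From mathcomp Require Import generic_quotient ring_quotient.
From mathcomp Require Import all_classical reals topology.
From mathcomp.multinomials Require Import freeg.

(** Relabelling sends every relator for [m] to a relator of the same kind for
    [n] ([dmap_relators]), so [dmap] maps the span of the former into the span
    of the latter and induces an additive map on the quotients
    ([Xquot_lift]).  The relations other than Q3 are easily seen to be
    respected: relabelling does not move the endpoints, preserves signs and
    equalities of labels, commutes with deleting an arrow, and turns the
    greatest label [m + 1] into the greatest label [n + 1].

    For Q3, note that capping is the map [k |-> min(k, n + 1)].  It is monotone,
    and it identifies two distinct labels only by sending both of them to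
    [n + 1].  Hence a strict inequality in one of the first three label
    conditions, such as [i > j = k], either survives capping or degenerates
    into the fourth condition, all three labels being [n + 1]
    ([Q3_labels_cap]).  This is the purpose of the fourth condition.

    Exactness at the target means that the induced map is onto.  Since
    [n <= m], each label allowed for [n] is allowed for [m] and fixed by
    capping, so already [dmap] is onto ([dmap_surj]). *)

Set Implicit Arguments.
Unset Strict Implicit.
Unset Printing Implicit Defensive.

Import GRing.Theory.
Local Open Scope ring_scope.
Local Open Scope quotient_scope.

Lemma map_rem_uniq (T U : eqType) (f : T -> U) (s : seq T) (x : T) :
  uniq (map f s) -> x \in s -> map f (rem x s) = rem (f x) (map f s).
Proof.
elim: s => //= y s IHs /andP[fy us]; rewrite inE eq_sym.
have [-> _|yx /= xs] := eqVneq y x; first by rewrite eqxx.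
rewrite ifN ?IHs //.
by apply: contraNneq fy => ->; apply: map_f.
Qed.

(** As capping is [min(_, n + 1)], it can destroy a strict inequality only by
    sending both sides to [n + 1]. *)
Lemma cap_elt (n x y : enat) : elt x y ->
  elt (cap n x) (cap n y) \/ cap n x = esucc n /\ cap n y = esucc n.
Proof.
case: n x y => [n|] [x|] [y|] //=; rewrite /cap /elt /= -?ltnNge; try by left.
  move=> xy; case: (ltnP n.+1 x) => nx; case: (ltnP n.+1 y) => ny /=.
  - by right.
  - by move: (leq_trans nx (leq_trans (ltnW xy) ny)); rewrite ltnn.
  - move: nx; rewrite leq_eqVlt => /orP[/eqP->|nx]; first by right.
    by left; rewrite -ltnNge.
  - by left; rewrite -ltnNge.
move=> _; case: (ltnP n.+1 x) => nx; first by right.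
move: nx; rewrite leq_eqVlt => /orP[/eqP->|nx]; first by right.
by left; rewrite /= -ltnNge.
Qed.

Lemma cap_top (n m : enat) : ele n m -> cap n (esucc m) = esucc n.
Proof.
case: n m => [n|] [m|] //=; rewrite /cap /elt /= -?ltnNge ltnS leq_eqVlt.
by case/orP=> [/eqP->|->] //; rewrite ltnn.
Qed.

Lemma label_inj (m : enat) (i j : label m) : sval i = sval j -> i = j.
Proof. exact: val_inj. Qed.

Lemma cap_label_top (n m : enat) :
  ele n m -> cap_label n (top_label m) = top_label n.
Proof. by move=> nm; apply: label_inj; apply: cap_top. Qed.

Lemma cap_label_elt (m n : enat) (i j : label m) : elt (sval j) (sval i) ->
  elt (sval (cap_label n j)) (sval (cap_label n i)) \/
  cap_label n j = top_label n /\ cap_label n i = top_label n.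
Proof.
by move=> /(cap_elt n)[lt|[ej ei]]; [left|right; split; apply: label_inj].
Qed.

Lemma Q3_labels_cap (m n : enat) (i j k : label m) : ele n m ->
  Q3_labels i j k ->
  Q3_labels (cap_label n i) (cap_label n j) (cap_label n k).
Proof.
move=> nm [[/(cap_label_elt n) h <-]|[/(cap_label_elt n) h <-]|
  [/(cap_label_elt n) h <-]|[-> -> ->]].
- by case: h => [?|[-> ->]]; [apply: Or41|apply: Or44].
- by case: h => [?|[-> ->]]; [apply: Or42|apply: Or44].
- by case: h => [?|[-> ->]]; [apply: Or43|apply: Or44].
- by rewrite cap_label_top //; apply: Or44.
Qed.

(** A label allowed for [n] is its own preimage. *)
Lemma cap_label_surj (m n : enat) : ele n m ->
  forall l : label n, exists k : label m, cap_label n k = l.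
Proof.
move=> nm [l hl]; have /andP[l1 ln] := hl.
have lm : is_label m l.
  rewrite /is_label l1 /=.
  case: m n l nm ln {hl l1} => [m|] [n|] [l|] //= nm ln.
  by apply: leq_trans ln _; rewrite ltnS.
exists (exist _ l lm); apply: label_inj.
by rewrite /= /cap /elt ln.
Qed.

(** Distinct arrows of a diagram have distinct tails, which relabelling keeps;
    so arrows that get the same label are not confused. *)
Lemma uniq_relabel (B : obase) (m n : enat) (D : diagram B m) :
  uniq (map (@relabel_arrow B m n) D).
Proof.
apply: (@map_uniq _ _ (@atail B n)); rewrite -map_comp.
apply: subseq_uniq (endpoints_uniq D).
elim: (arrows D) => //= a s IHs.
by rewrite eqxx; apply: subseq_trans IHs (subseq_cons _ _).
Qed.

(** Deletion removes the first occurrence of an arrow from a list; it commutes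
    with relabelling because relabelling is injective on the arrows of [D]. *)
Lemma relabel_del (B : obase) (m n : enat) (D : diagram B m) (a : arrow B m) :
  a \in arrows D -> relabel n (del D a) = del (relabel n D) (relabel_arrow n a).
Proof.
by move=> aD; apply: val_inj; rewrite /= map_rem_uniq // uniq_relabel.
Qed.

Lemma follows_relabel (B : obase) (m n : enat) (D : diagram B m) (p q : B) :
  follows (relabel n D) p q = follows D p q.
Proof. by rewrite /follows endpoints_relabel. Qed.

Lemma adjacent_relabel (B : obase) (m n : enat) (D : diagram B m) (p q : B) :
  adjacent (relabel n D) p q = adjacent D p q.
Proof. by rewrite /adjacent !follows_relabel. Qed.

(** Each relator goes to a relator of the same kind, not just to a
    combination of relators; only the label condition of Q3 needs an argument. *)
Lemma dmap_relators (B : obase) (m n : enat) (t : nat) (x : zdiag B m) :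
  ele n m -> relators t x -> relators t (dmap n x).
Proof.
move=> nm [[[|]|]|].
- case=> D a aD isoD la; rewrite dmap_gen; left; left; left.
  apply: (Q1_intro (a := relabel_arrow n a)).
  + exact: map_f.
  + by rewrite /Defs.isolated adjacent_relabel.
  + by rewrite /= la cap_label_top.
- case=> D a b aD bD sab lab tab hab; left; left; right.
  rewrite !raddfD /= !dmap_gen !relabel_del //.
  apply: Q2_intro; rewrite ?map_f ?adjacent_relabel //=.
  by rewrite lab.
- case=> D D' E p1 p2 q1 q2 r1 r2 s i j k a b c a' b' c' DE D'E fp fq fr lab.
  have relF (F : diagram B m) p q : follows F p q -> follows (relabel n F) p q.
    by rewrite follows_relabel.
  left; right; rewrite raddfB /= !(raddfD (@dmap B m n)) /= !dmap_gen !relabel_del;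
    try by rewrite ?(perm_mem DE) ?(perm_mem D'E) !inE eqxx ?orbT.
  exact: (@Q3_intro B n (relabel n D) (relabel n D') (map (relabel_arrow n) E)
    p1 p2 q1 q2 r1 r2 s (cap_label n i) (cap_label n j) (cap_label n k)
    (perm_map (relabel_arrow n) DE) (perm_map (relabel_arrow n) D'E)
    (relF D _ _ fp) (relF D _ _ fq) (relF D _ _ fr) (Q3_labels_cap nm lab)).
- by case=> D tD; rewrite dmap_gen; right; apply: At_intro; rewrite size_map.
Qed.

Lemma relabel_surj (B : obase) (m n : enat) (D : diagram B n) : ele n m ->
  exists D' : diagram B m, relabel n D' = D.
Proof.
move=> nm; have /choice[g gK] := @cap_label_surj m n nm.
pose lift (a : arrow B n) := Arrow (atail a) (ahead a) (asign a) (g (alabel a)).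
have liftK : map (relabel_arrow n) (map lift D) = D.
  rewrite -map_comp -[RHS]map_id; apply: eq_map => -[p q s l].
  by rewrite /relabel_arrow /= gK.
have Du : uniq (endpoints (map lift D)).
  by rewrite /endpoints -map_comp; apply: (endpoints_uniq D).
by exists (Diagram Du); apply: val_inj.
Qed.

Lemma dmap_surj (B : obase) (m n : enat) (y : zdiag B n) : ele n m ->
  exists x : zdiag B m, dmap n x = y.
Proof.
move=> nm; elim/freeg_ind_dom0: y => [|c d y _ _ [x <-]].
  by exists 0; rewrite raddf0.
have [D eD] := relabel_surj (repr d) nm.
(* [c] is the coefficient of the diagram [d] split off by the induction. *)
exists (gen D *~ c + x); rewrite raddfD raddfMz /= dmap_gen eD /gen reprK.
by rewrite freegU_mulz intz.
Qed.

(** The preimage of the span of [H] under [f] is a subgroup. *)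
Lemma zspan_morph (V W : zmodType) (f : {additive V -> W}) (G : set V)
    (H : set W) : (forall x, G x -> zspan H (f x)) ->
  forall x, zspan G x -> zspan H (f x).
Proof.
move=> GH x Gx; apply: (Gx (fun v => zspan H (f v))); split=> //.
split=> [|y z Hy Hz].
  by rewrite raddf0; apply/asboolP; exact: (zspanb_closed H).1.
by rewrite raddfB; apply/asboolP/(zspanb_closed H).2; apply/asboolP.
Qed.

Lemma Xpi_eq (B : obase) (t : nat) (m : enat) (x y : zdiag B m) :
  Xpi t x = Xpi t y <-> zspan (relators t) (x - y).
Proof.
split=> [/eqP|h]; last apply/eqP.
  by rewrite /Xpi -Quotient.idealrBE => /asboolP.
by rewrite /Xpi -Quotient.idealrBE; apply/asboolP.
Qed.

Lemma Xpi_surj (B : obase) (t : nat) (m : enat) (y : Xquot B t m) :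
  exists x, Xpi t x = y.
Proof. by exists (repr y); rewrite /Xpi reprK. Qed.

Lemma Xquot_lift (B B' : obase) (t t' : nat) (m n : enat)
    (f : {additive zdiag B m -> zdiag B' n}) :
    (forall x, relators t x -> zspan (relators t') (f x)) ->
  exists g : {additive Xquot B t m -> Xquot B' t' n},
    forall x, g (Xpi t x) = Xpi t' (f x).
Proof.
move=> fR; pose g (y : Xquot B t m) := Xpi t' (f (repr y)).
(* The representative of [Xpi t x] differs from [x] by a combination of relators. *)
have gE x : g (Xpi t x) = Xpi t' (f x).
  apply/Xpi_eq; rewrite -raddfB; apply: (zspan_morph fR).
  by apply/Xpi_eq; rewrite /Xpi reprK.
have gB : zmod_morphism g.
  move=> x y; have [u <-] := Xpi_surj x; have [v <-] := Xpi_surj y.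
  by rewrite -raddfB !gE !raddfB.
pose gM := GRing.isZmodMorphism.Build _ _ _ gB.
pose gA : {additive Xquot B t m -> Xquot B' t' n} := HB.pack g gM.
by exists gA.
Qed.

Theorem lemma3 (R : realType) (k : base_kind) (m n : enat) (t : nat)
    (hn : ele (Some 1%N) n) (hnm : ele n m) :
  exists dt : {additive Xquot (base R k) t m -> Xquot (base R k) t n},
    (forall x : zdiag (base R k) m, dt (Xpi t x) = Xpi t (dmap n x)) /\
    is_exact dt (fun _ : Xquot (base R k) t n => 0 : 'rV[int]_0).
Proof.
have [x rx|dt dtE] := @Xquot_lift _ _ t t _ _ (@dmap (base R k) m n).
  by move=> H [_]; apply; apply: dmap_relators.
(* The kernel of the zero map is the whole quotient. *)
exists dt; split=> //; rewrite /is_exact; apply/seteqP; split=> // y _.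
have [z <-] := Xpi_surj y; have [x <-] := @dmap_surj _ m _ z hnm.
by exists (Xpi t x).
Qed.
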